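(* Let $\mathcal{X}=\{x_1,\dots,x_N\}\subset\mathbb{R}^d$ be a finite dataset equipped with a metric $d$. The family of $k$-nearest-neighbor cluster sets $\{\mathcal{C}_i^k\}_{i=1}^{I_k}$, $k=0,1,\dots$ (defined in the context), forms a hierarchical clustering of $\mathcal{X}$: at the bottom layer $I_0=N$ and the clusters are the individual samples, $\mathcal{C}_i^0=\{x_i\}$ for $i\in\{1,\dots,N\}$ (up to relabeling); for each $k$, every cluster $\mathcal{C}_i^{k+1}$ is a union of clusters $\mathcal{C}_j^k$; and there exists some $k^*$ such that the top layer has $I_{k^*}=1$ cluster, namely $\mathcal{C}_1^{k^*}=\mathcal{X}$.
   Context: For $x\in\mathcal{X}$, order the points of $\mathcal{X}\setminus\{x\}$ by nondecreasing distance $d(x,\cdot)$ (ties broken by a fixed rule), and let $\mathcal{N}_k(x)$ be the set of the first $k$ points in this order (the $k$ nearest neighbors of $x$; $\mathcal{N}_0(x)=\emptyset$), for $0\le k\le N-1$. The $k$-nearest-neighbor cluster set $\{\mathcal{C}_i^k\}_{i=1}^{I_k}$ is a partition of $\mathcal{X}$ into pairwise disjoint sets whose union is $\mathcal{X}$, such that each cluster contains the $k$ nearest neighbors of every one of its elements ($\mathcal{N}_k(x)\subseteq\mathcal{C}_i^k$ for all $x\in\mathcal{C}_i^k$), and $I_k$ is the maximum number of clusters among all partitions with this property. *)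

(* Defs.v *)
From mathcomp Require Import all_boot all_order all_algebra.
From mathcomp Require Export finmap reals.

Set Implicit Arguments.
Unset Strict Implicit.
Unset Printing Implicit Defensive.

Import Order.TTheory GRing.Theory Num.Theory.
Local Open Scope ring_scope.

(* Metrics are predicates on functions rather than [metricType] instances: the
   dataset is a subtype of ['rV_n], and its metric is arbitrary, not the one
   induced by the norm of ['rV_n]. *)
Definition is_metric (R : realType) (T : Type) (d : T -> T -> R) : Prop :=
  [/\ forall x y, 0 <= d x y,
      forall x y, d x y = 0 <-> x = y,
      forall x y, d x y = d y x
    & forall x y z, d x z <= d x y + d y z].

Definition total_order (T : Type) (le : rel T) : Prop :=
  [/\ reflexive le, antisymmetric le, transitive le & total le].

(* [tie x] is the order used to compare points at the same distance from [x];
   an index order on the dataset is the case where [tie x] does not depend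
   on [x]. *)
Definition nn_le (R : realType) (T : Type) (d : T -> T -> R) (tie : T -> rel T)
    (x : T) : rel T :=
  fun y z => (d x y < d x z) || ((d x y == d x z) && tie x y z).

Definition nearest (R : realType) (T : finType) (d : T -> T -> R)
    (tie : T -> rel T) (k : nat) (x : T) : {set T} :=
  [set y in take k (sort (nn_le d tie x) (enum [set~ x]))].

(* The blocks of a [partition] are nonempty, so [#|P|] is the number of
   clusters. *)
Definition nn_closed_partition (R : realType) (T : finType) (d : T -> T -> R)
    (tie : T -> rel T) (k : nat) (P : {set {set T}}) : bool :=
  partition P [set: T] &&
  [forall A in P, forall x in A, nearest d tie k x \subset A].

Definition max_nclusters (R : realType) (T : finType) (d : T -> T -> R)
    (tie : T -> rel T) (k : nat) : nat :=
  \max_(P : {set {set T}} | nn_closed_partition d tie k P) #|P|.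

Definition knn_cluster_set (R : realType) (T : finType) (d : T -> T -> R)
    (tie : T -> rel T) (k : nat) (P : {set {set T}}) : Prop :=
  nn_closed_partition d tie k P /\ #|P| = max_nclusters d tie k.

Lemma knn_cluster_set_exists (R : realType) (T : finType) (d : T -> T -> R)
    (tie : T -> rel T) (k : nat) :
  (0 < #|T|)%N -> exists P, knn_cluster_set d tie k P.
Proof.
move=> T_gt0.
have closedT : nn_closed_partition d tie k [set [set: T]].
  apply/andP; split; last first.
    apply/forall_inP => A /set1P ->; apply/forall_inP => x _.
    exact: subsetT.
  rewrite /partition /cover big_set1 eqxx trivIset1 /= inE eq_sym.
  by rewrite -card_gt0 cardsT.
have [|P closedP maxP] := @eq_bigmax_cond _ (nn_closed_partition d tie k)
  (fun P : {set {set T}} => #|P|).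
  by apply/card_gt0P; exists [set [set: T]].
by exists P; split.
Qed.

(* Main.v *)
Require Import Defs.
From mathcomp Require Import all_boot all_order all_algebra.

(** A cluster set of maximal cardinality refines every other closed partition:
    if a block [A] of it met a block [B] of a closed partition without being
    contained in it, cutting [A] into [A :&: B] and [A :\: B] would give a closed
    partition with one more block.  Closedness for [k.+1] implies closedness
    for [k], which gives the nesting; singletons are closed for [k = 0], and the
    whole dataset is the only closed block for [k = N - 1]. *)

Set Implicit Arguments.
Unset Strict Implicit.
Unset Printing Implicit Defensive.

(** Dropping [A] leaves a partition of [D :\: A]; the two pieces of [A] are then added back one at a
    time, each nonempty and disjoint from what is already covered. *)
Lemma partition_split (T : finType) (P : {set {set T}}) (D A B : {set T}) :
    partition P D -> A \in P -> A :&: B != set0 -> A :\: B != set0 ->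
  partition (A :&: B |: (A :\: B |: P :\ A)) D /\
  #|A :&: B |: (A :\: B |: P :\ A)| = #|P|.+1.
Proof.
move=> partP PA AIB_neq0 ADB_neq0.
have AD : A \subset D by rewrite -(cover_partition partP) (bigcup_max A).
have part1 : partition (A :\: B |: P :\ A) (A :\: B :|: D :\: A).
  apply: partitionU1 => //; first exact: partitionD1.
  rewrite -setI_eq0; apply/eqP/setP => x; rewrite !inE.
  by case: (x \in A); rewrite ?andbF.
have dis2 : [disjoint A :&: B & A :\: B :|: D :\: A].
  rewrite -setI_eq0; apply/eqP/setP => x; rewrite !inE.
  by case: (x \in A); case: (x \in B).
have part2 := partitionU1 part1 AIB_neq0 dis2.
have eqD : A :&: B :|: (A :\: B :|: D :\: A) = D.
  by rewrite setUA setID -{1}(setIidPr AD) setID.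
rewrite eqD in part2; split=> //.
(* A nonempty set disjoint from the covered set cannot already be a block, so each insertion raises
   the cardinal by one; this offsets the removal of [A] and gains one block. *)
have notin (E F : {set T}) (Q : {set {set T}}) :
    partition Q F -> E != set0 -> [disjoint E & F] -> E \notin Q.
  move=> partQ E_neq0 disEF; apply: contra E_neq0 => QE.
  rewrite -(setIidPl _ : E :&: F = E) ?setI_eq0 //.
  by rewrite -(cover_partition partQ) (bigcup_max E).
rewrite cardsU1 (notin _ _ _ part1) // cardsU1.
rewrite (notin _ _ _ (partitionD1 partP PA)) //.
  by rewrite (cardsD1 A P) PA.
rewrite -setI_eq0; apply/eqP/setP => x; rewrite !inE.
by case: (x \in A); rewrite ?andbF.
Qed.

Lemma partition_blockP (T : finType) (P : {set {set T}}) (x : T) :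
  partition P [set: T] -> exists2 B, B \in P & x \in B.
Proof.
move=> partP; exists (pblock P x); last first.
  by rewrite mem_pblock (cover_partition partP).
by apply: pblock_mem; rewrite (cover_partition partP).
Qed.

Section NearestNeighborClusters.

Variables (R : realType) (T : finType) (d : T -> T -> R) (tie : T -> rel T).
Implicit Types (k : nat) (P Q : {set {set T}}) (A B : {set T}).

Lemma nn_closed_partitionP k P :
  reflect (partition P [set: T] /\
           forall A x, A \in P -> x \in A -> nearest d tie k x \subset A)
          (nn_closed_partition d tie k P).
Proof.
apply: (iffP andP) => -[partP clP]; split=> //.
  by move=> A x PA Ax; move/forall_inP: clP => /(_ A PA)/forall_inP; apply.
by apply/forall_inP => A PA; apply/forall_inP => x; apply: clP.
Qed.

Lemma nearest0 x : nearest d tie 0 x = set0.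
Proof. by apply/setP => y; rewrite !inE take0. Qed.

Lemma nearest_subset k l x :
  k <= l -> nearest d tie k x \subset nearest d tie l x.
Proof.
move=> le_kl; apply/subsetP => y; rewrite !inE -(take_takel _ le_kl).
exact: mem_take.
Qed.

(** The sorted list has exactly [#|T|.-1] entries, so [take] keeps all of it. *)
Lemma nearest_max x : nearest d tie #|T|.-1 x = [set~ x].
Proof.
apply/setP => y; rewrite inE take_oversize ?mem_sort ?mem_enum //.
by rewrite size_sort -cardE cardsC1.
Qed.

Lemma nn_closed_partition_leq k l P :
  k <= l -> nn_closed_partition d tie l P -> nn_closed_partition d tie k P.
Proof.
move=> le_kl /nn_closed_partitionP [partP clP].
apply/nn_closed_partitionP; split=> // A x PA Ax.
exact: subset_trans (nearest_subset x le_kl) (clP A x PA Ax).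
Qed.

Lemma knn_cluster_set_refines k P Q A B :
    knn_cluster_set d tie k P -> nn_closed_partition d tie k Q ->
    A \in P -> B \in Q -> A :&: B != set0 ->
  A \subset B.
Proof.
move=> [/nn_closed_partitionP [partP clP] maxP].
move=> /nn_closed_partitionP [partQ clQ] PA QB AIB_neq0.
rewrite -setD_eq0; apply/negPn/negP => ADB_neq0.
have [part' card'] := partition_split partP PA AIB_neq0 ADB_neq0.
set P' := (_ |: _) in part' card'.
suff clP' : nn_closed_partition d tie k P'.
  have : #|P'| <= max_nclusters d tie k by apply: leq_bigmax_cond.
  by rewrite -maxP card' ltnn.
apply/nn_closed_partitionP; split=> // E x /setU1P [-> | /setU1P [-> |]].
- by case/setIP => Ax Bx; rewrite subsetI clP // clQ.
- case/setDP => Ax nBx; rewrite subsetD clP //=.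
  (* The neighbors of a point outside [B] stay in its own block [F] of [Q], which is disjoint from
     [B]. *)
  have [F QF Fx] := partition_blockP x partQ.
  have neqFB : F != B by apply: contraNneq nBx => <-.
  have /and3P [_ /trivIsetP/(_ F B QF QB neqFB) disFB _] := partQ.
  exact: disjointWl (clQ F x QF Fx) disFB.
- by case/setD1P => _ PE Ex; apply: clP.
Qed.

(** Each point of [B] lies in a block of [P] that meets [B], hence is contained in [B] by
    refinement; [S] collects these blocks. *)
Lemma knn_cluster_set_cover k P Q B :
    knn_cluster_set d tie k P -> nn_closed_partition d tie k Q -> B \in Q ->
  exists S : {set {set T}}, S \subset P /\ B = cover S.
Proof.
move=> knnP clQ QB; exists [set A in P | A \subset B].
split; first by apply/subsetP => A; rewrite inE => /andP [].
apply/setP => x; apply/idP/bigcupP => [Bx | [A]]; last first.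
  by rewrite inE => /andP [_ /subsetP]; apply.
have /nn_closed_partitionP [partP _] := knnP.1.
have [A PA Ax] := partition_blockP x partP.
exists A => //; rewrite inE PA.
apply: (knn_cluster_set_refines knnP clQ) => //.
by apply/set0Pn; exists x; apply/setIP.
Qed.

Lemma nn_closed_singletons : nn_closed_partition d tie 0 [set [set x] | x : T].
Proof.
apply/nn_closed_partitionP; split; last first.
  by move=> A x _ _; rewrite nearest0 sub0set.
apply/and3P; split.
- rewrite -subTset; apply/subsetP => x _; apply/bigcupP.
  by exists [set x]; rewrite ?inE // imset_f.
- apply/trivIsetP => _ _ /imsetP [x _ ->] /imsetP [y _ ->] neq_xy.
  by rewrite disjoints1 inE; apply: contraNneq neq_xy => ->.
- by apply/imsetP => -[x _ /setP/(_ x)]; rewrite !inE eqxx.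
Qed.

(** [P] refines the partition into singletons, which is closed because there are no neighbors to
    contain. *)
Lemma knn_cluster_set0 P :
  knn_cluster_set d tie 0 P -> P = [set [set x] | x : T].
Proof.
move=> knnP; have /nn_closed_partitionP [partP _] := knnP.1.
have blockE x A : A \in P -> x \in A -> A = [set x].
  move=> PA Ax; apply/eqP; rewrite eqEsubset sub1set Ax andbT.
  apply: (knn_cluster_set_refines knnP nn_closed_singletons) => //.
    exact: imset_f.
  by apply/set0Pn; exists x; rewrite !inE Ax eqxx.
apply/setP => A; apply/idP/imsetP => [PA | [x _ ->]].
  have /set0Pn [x Ax] : A != set0.
    by apply: contraTneq PA => ->; case/and3P: partP.
  by exists x => //; apply: blockE.
by have [B PB Bx] := partition_blockP x partP; rewrite -(blockE x B).
Qed.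

(** A block containing [x] also contains all other points as neighbors of [x]. Nonemptiness of [T]
    matters: the only partition of the empty set has no block. *)
Lemma nn_closed_partition_max P :
  0 < #|T| -> nn_closed_partition d tie #|T|.-1 P -> P = [set [set: T]].
Proof.
move=> /card_gt0P [x0 _] /nn_closed_partitionP [partP clP].
have blockT A x : A \in P -> x \in A -> A = [set: T].
  move=> PA Ax; apply/eqP; rewrite -subTset -(setUCr [set x]).
  by rewrite subUset sub1set Ax -(nearest_max x) clP.
apply/setP => A; rewrite inE; apply/idP/eqP => [PA | ->].
  have /set0Pn [x] : A != set0.
    by apply: contraTneq PA => ->; case/and3P: partP.
  exact: blockT.
by have [B PB Bx] := partition_blockP x0 partP; rewrite -(blockT B x0).
Qed.

End NearestNeighborClusters.

Theorem theorem1 (R : realType) (n : nat) (X : {fset 'rV[R]_n})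
    (X_neq0 : (0 < #|` X|)%N)
    (d : X -> X -> R) (d_metric : is_metric d)
    (tie : X -> rel X) (tie_order : forall x : X, total_order (tie x))
    (C : nat -> {set {set X}})
    (C_knn : forall k : nat, (k < #|` X|)%N -> knn_cluster_set d tie k (C k)) :
  [/\ max_nclusters d tie 0 = #|` X| /\ C 0 = [set [set x] | x : X],
      forall k : nat, (k.+1 < #|` X|)%N -> forall A : {set X}, A \in C k.+1 ->
        exists S : {set {set X}}, S \subset C k /\ A = cover S
    & exists k : nat,
        [/\ (k < #|` X|)%N, max_nclusters d tie k = 1
          & C k = [set [set: X]]]].
Proof.
split.
- have C0 := C_knn 0 X_neq0; have eqC0 := knn_cluster_set0 C0.
  split=> //; rewrite -C0.2 eqC0 cardfE.
  by rewrite card_imset //; exact: set1_inj.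
(* [C k.+1] is maximal only for [k.+1], but refinement by [C k] asks only that it be closed for
   [k]. *)
- move=> k ltkX A CA; have [clC _] := C_knn _ ltkX.
  apply: (knn_cluster_set_cover (C_knn k (ltnW ltkX)) _ CA).
  exact: nn_closed_partition_leq clC.
(* The top layer is the last admissible index, where every other point is a neighbor. *)
- have lt_max : #|` X|.-1 < #|` X| by rewrite prednK.
  have [clC cardC] := C_knn _ lt_max.
  have eqC : C #|` X|.-1 = [set [set: X]].
    rewrite cardfE in X_neq0 clC *; exact: nn_closed_partition_max clC.
  by exists #|` X|.-1; split=> //; rewrite -cardC eqC cards1.
Qed.
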